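(* Let $i\in[N]$, let $(t_1,t_2)\in A^{\rm temporal}$, let $J=[t_1,t_2-1]$ be the associated cyclic interval of $\hat T$ periods, and let the order-up-to level $s_{it_1}\in\mathbb{Z}_{\ge 0}$ be given. Then the worst-case inventory cost $$f^{\rm inv}(i,t_1,t_2,s_{it_1})=\sup_{\mathbb{P}\in\mathcal{P}}\mathbb{E}_{\mathbb{P}}\Bigl[h\sum_{t\in J}\bigl(s_{it_1}-\sum_{t'\in[t_1,t]}\zeta^i_{t'}\bigr)^+ + b\sum_{t\in J}\bigl(s_{it_1}-\sum_{t'\in[t_1,t]}\zeta^i_{t'}\bigr)^-\Bigr]$$ equals the optimal value of the following (linearizable) optimization problem (LOP) in the variables $\pi_{\hat t}\in\mathbb{R}_+$ and $\boldsymbol\lambda_{\hat t}=(\lambda_{\hat t t})_{t\in J}\in\mathbb{R}^{\hat T}$, $\hat t\in J\cup\{0\}$: $$\max\ \sum_{\hat t\in J}\Bigl(h\sum_{t\in[t_1,\hat t)}\bigl(\pi_{\hat t}s_{it_1}-\sum_{t'\in[t_1,t]}\lambda_{\hat t t'}\bigr)+b\sum_{t\in[\hat t,t_2-1]}\bigl(\sum_{t'\in[t_1,t]}\lambda_{\hat t t'}-\pi_{\hat t}s_{it_1}\bigr)\Bigr)+h\sum_{t\in J}\bigl(\pi_0s_{it_1}-\sum_{t'\in[t_1,t]}\lambda_{0t'}\bigr)$$ subject to $$\sum_{\hat t\in J\cup\{0\}}\pi_{\hat t}=1,$$ $$\sum_{\hat t\in J\cup\{0\}}\lambda_{\hat t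 t}=\mu^i_t\quad\forall t\in J,$$ $$\sum_{\hat t\in J\cup\{0\}}|\lambda_{\hat t t}-\pi_{\hat t}\mu^i_t|\le\sigma^i_t\quad\forall t\in J,$$ $$\pi_{\hat t}\underline\zeta^i_t\le\lambda_{\hat t t}\le\pi_{\hat t}\bar\zeta^i_t\quad\forall t\in J,\ \hat t\in J\cup\{0\},$$ $$\sum_{t\in[t_1,\hat t)}\lambda_{\hat t t}\le\pi_{\hat t}s_{it_1}\le\sum_{t\in[t_1,\hat t]}\lambda_{\hat t t}\quad\forall\hat t\in J,$$ $$\sum_{t\in J}\lambda_{0t}\le\pi_0s_{it_1},$$ $$\pi_{\hat t}\in\mathbb{R}_+,\ \boldsymbol\lambda_{\hat t}\in\mathbb{R}^{\hat T}\quad\forall\hat t\in J\cup\{0\}.$$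
   Context: Let $N,T\ge1$ be integers, $[n]=\{1,\dots,n\}$, and $A^{\rm temporal}\subseteq[T]\times[T]$. Periods are cyclic: period $T$ is followed by period $1$. For $(t_1,t_2)\in A^{\rm temporal}$ put $\hat T=t_2-t_1$ if $t_2>t_1$ and $\hat T=t_2+T-t_1$ otherwise (so $1\le\hat T\le T$). The cyclic interval $J=[t_1,t_2-1]$ is the ordered sequence of $\hat T$ consecutive periods $t_1,t_1+1,\dots$ (wrapping around from $T$ to $1$ if needed) ending in the predecessor of $t_2$. For $t,\hat t\in J$: $[t_1,t]$ is the set of periods of $J$ from $t_1$ up to and including $t$ in this order; $[t_1,\hat t)$ is the set of periods of $J$ strictly before $\hat t$; $[\hat t,t_2-1]$ is the set of periods of $J$ from $\hat t$ (included) to the end. The index $0$ is an extra symbol not in $J$. Empty sums are $0$. For $x\in\mathbb{R}$: $x^+=\max\{x,0\}$, $x^-=\max\{-x,0\}$. $h,b\ge0$ are the per-unit holding and backorder costs. For $i\in[N]$, $t\in[T]$ the data are reals with $0\le\underline\zeta^i_t<\mu^i_t<\bar\zeta^i_t$ and $\sigma^i_t\ge0$. The ambiguity set $\mathcal{P}$ is the set of all probability distributions $\mathbb{P}$ of the random demand vector $\boldsymbol\zeta=(\zeta^i_t)_{i\in[N],t\in[T]}$ such that for all $i\in[N]$, $t\in[T]$: $\mathbb{P}(\zeta^i_t\in[\underline\zeta^i_t,\bar\zeta^i_t])=1$ (real interval), $\mathbb{E}_{\mathbb{P}}[\zeta^i_t]=\mu^i_t$, and $\mathbb{E}_{\mathbb{P}}[|\zeta^i_t-\mu^i_t|]\le\sigma^i_t$.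 No other condition (in particular no independence) is imposed on members of $\mathcal{P}$. *)

(* Defs.v *)
From HB Require Import structures.
From mathcomp Require Export all_boot all_order all_algebra.
From mathcomp Require Export all_classical all_reals all_analysis.

Set Implicit Arguments.
Unset Strict Implicit.
Unset Printing Implicit Defensive.

Import Order.TTheory GRing.Theory Num.Theory.
Import numFieldNormedType.Exports.

Local Open Scope classical_set_scope.
Local Open Scope ring_scope.

(* The T periods are the elements of 'I_T (period number minus one), and the
   library's [ordS] is the cyclic successor.  [horizon t1 t2] is the length
   (written T-hat) of the cyclic interval J = [t1, t2 - 1]. *)
Definition horizon (T : nat) (t1 t2 : 'I_T) : nat :=
  if (t1 < t2)%N then (t2 - t1)%N else (t2 + T - t1)%N.

(* J is encoded by positions: k : 'I_(horizon t1 t2) stands for the period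
   of J that is k steps after t1, namely [period t1 k].  The cyclic order
   on J is thus the usual order on positions: [t1, t] is {k | k <= t},
   [t1, t) is {k | k < t}, and [t, t2 - 1] is {k | t <= k}. *)
Definition period (T : nat) (t1 : 'I_T) (k : nat) : 'I_T := iter k (@ordS T) t1.

Lemma period_horizon (T : nat) (t1 t2 : 'I_T) :
  period t1 (horizon t1 t2) = t2.
Proof.
have periodE k : period t1 k = ((t1 + k) %% T)%N :> nat.
  elim: k => [|k IH]; first by rewrite addn0 modn_small.
  by rewrite /period iterS /= -[iter k _ _]/(period t1 k) IH -addn1 modnDml
             -addnA addn1.
apply: val_inj; rewrite /= periodE /horizon; case: ltnP => H.
  by rewrite subnKC ?modn_small // ltnW.
by rewrite subnKC ?modnDr ?modn_small // (leq_trans (ltnW (ltn_ord t1))) ?leq_addl.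
Qed.

(* A realization of the demand vector is an N-tuple of T-tuples of reals; the
   library equips tuples with the product sigma-algebra, here the Borel
   sigma-algebra of R^(N * T). *)
Definition demand (R : realType) (N T : nat) (i : 'I_N) (t : 'I_T)
  (z : N.-tuple (T.-tuple R)) : R := tnth (tnth z i) t.

Definition ambiguity_set (R : realType) (N T : nat)
    (zlo mu zhi sigma : 'I_N -> 'I_T -> R) :
    set (probability (N.-tuple (T.-tuple R)) R) :=
  [set P : probability (N.-tuple (T.-tuple R)) R | forall i t,
    [/\ P [set z | zlo i t <= demand i t z <= zhi i t] = 1%E,
        'E_P[demand i t]%E = (mu i t)%:E &
        ('E_P[(fun z => `|demand i t z - mu i t|)%R] <= (sigma i t)%:E)%E]].

Definition inventory_cost (R : realType) (N T : nat) (h b : R)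
    (i : 'I_N) (t1 t2 : 'I_T) (s : nat) (z : N.-tuple (T.-tuple R)) : R :=
  let net (t : 'I_(horizon t1 t2)) : R :=
    s%:R - \sum_(t' < horizon t1 t2 | (t' <= t)%N) demand i (period t1 t') z in
  h * (\sum_(t < horizon t1 t2) Num.max (net t) 0) +
  b * (\sum_(t < horizon t1 t2) Num.max (- net t) 0).

Definition worst_case_cost (R : realType) (N T : nat) (h b : R)
    (zlo mu zhi sigma : 'I_N -> 'I_T -> R)
    (i : 'I_N) (t1 t2 : 'I_T) (s : nat) : \bar R :=
  ereal_sup [set 'E_P[inventory_cost h b i t1 t2 s]%E |
             P in ambiguity_set zlo mu zhi sigma].

(* In the optimization problem m = |J| and the index set J u {0} is
   [option 'I_m], with [None] for the extra symbol 0; [lam j t] is lambda_{j t}.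
   The data zlo, mu, zhi, sigma are indexed by positions in J. *)
Definition lop_objective (R : realType) (m : nat) (h b s : R)
    (pi : option 'I_m -> R) (lam : option 'I_m -> 'I_m -> R) : R :=
  \sum_(j < m)
    (h * (\sum_(t < m | (t < j)%N)
            (pi (Some j) * s - \sum_(t' < m | (t' <= t)%N) lam (Some j) t')) +
     b * (\sum_(t < m | (j <= t)%N)
            (\sum_(t' < m | (t' <= t)%N) lam (Some j) t' - pi (Some j) * s))) +
  h * (\sum_(t < m) (pi None * s - \sum_(t' < m | (t' <= t)%N) lam None t')).

Record lop_feasible (R : realType) (m : nat) (s : R)
    (zlo mu zhi sigma : 'I_m -> R)
    (pi : option 'I_m -> R) (lam : option 'I_m -> 'I_m -> R) : Prop := {
  lop_prob : \sum_j pi j = 1;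
  lop_mean : forall t, \sum_j lam j t = mu t;
  lop_dispersion : forall t, \sum_j `|lam j t - pi j * mu t| <= sigma t;
  lop_support : forall t j, pi j * zlo t <= lam j t <= pi j * zhi t;
  lop_crossing : forall j : 'I_m,
    \sum_(t < m | (t < j)%N) lam (Some j) t <= pi (Some j) * s
      <= \sum_(t < m | (t <= j)%N) lam (Some j) t;
  lop_no_crossing : \sum_(t < m) lam None t <= pi None * s;
  lop_nonneg : forall j, 0 <= pi j
}.

Definition lop_values (R : realType) (m : nat) (h b s : R)
    (zlo mu zhi sigma : 'I_m -> R) : set R :=
  [set v | exists pi lam,
    lop_feasible s zlo mu zhi sigma pi lam /\ v = lop_objective h b s pi lam].

Definition is_maximum (R : realType) (V : set R) (v : R) : Prop :=
  V v /\ ubound V v.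

(* Main.v *)
(* Split the probability space according to the period j in which the cumulated
   demand first reaches s (j = None if it never does).  On each piece the cost
   is linear in the demand, so the masses pi_j and the partial expectations
   lambda_j of the demand over the pieces form a feasible point of the LOP whose
   objective is the expected cost.  Conversely, a feasible point is realized by
   the discrete distribution putting mass pi_j on the demand path
   lambda_j / pi_j, with all demands outside J frozen at their means.  Hence the
   expected costs over the ambiguity set are exactly the values of the LOP, whose
   maximum is attained because its feasible set is compact. *)
From HB Require Import structures.
Require Import Defs.
From mathcomp Require Import measurable_realfun.

Set Implicit Arguments.
Unset Strict Implicit.
Unset Printing Implicit Defensive.

Import Order.TTheory GRing.Theory Num.Theory.
Import numFieldNormedType.Exports.

Local Open Scope classical_set_scope.
Local Open Scope ring_scope.

(** * Partial sums, crossings and the cost along one demand path *)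

Definition psum (R : realType) (m : nat) (x : 'I_m -> R) (n : nat) : R :=
  \sum_(t < m | (t < n)%N) x t.

Definition path_cost (R : realType) (m : nat) (h b s : R) (x : 'I_m -> R) : R :=
  h * (\sum_(t < m) Num.max (s - psum x t.+1) 0) +
  b * (\sum_(t < m) Num.max (- (s - psum x t.+1)) 0).

(** The slope of the cost in the net inventory of period [t] when [s] is crossed at [j]: stock is
    held before [j], demand is backordered from [j] on. *)
Definition lop_weight (R : realType) (m : nat) (h b : R) (j : option 'I_m)
    (t : 'I_m) : R :=
  if j is Some k then (if (t < k)%N then h else - b) else h.

(** Homogeneous in [p] and [l], so that one predicate serves as the crossing constraint of the LOP
    ([p = pi j], [l = lam j]), as a condition on a single path ([p = 1]) and as its restriction to
    one piece ([p] an indicator). *)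
Definition crosses (R : realType) (m : nat) (s : R) (j : option 'I_m) (p : R)
    (l : 'I_m -> R) : Prop :=
  if j is Some k then psum l k <= p * s <= psum l k.+1 else psum l m <= p * s.

Lemma big_option_sum (V : nmodType) (I : finType) (F : option I -> V) :
  \sum_j F j = F None + \sum_i F (Some i).
Proof.
rewrite (bigD1 None)//=; congr (_ + _).
rewrite (reindex_omap Some id) => /=; last by case.
by apply: eq_bigl => i; rewrite eqxx.
Qed.

Section PathCost.
Variables (R : realType) (m : nat).
Implicit Types (x l : 'I_m -> R) (j : option 'I_m) (h b s p : R).

Lemma psum0 x : psum x 0 = 0.
Proof. by rewrite /psum big_pred0. Qed.

Lemma psum_full x : psum x m = \sum_(t < m) x t.
Proof. by apply: eq_bigl => t; rewrite ltn_ord. Qed.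

Lemma psumZ p x n : psum (fun t => p * x t) n = p * psum x n.
Proof. by rewrite /psum mulr_sumr. Qed.

Lemma le_psum x n1 n2 : (forall t, 0 <= x t) -> (n1 <= n2)%N ->
  psum x n1 <= psum x n2.
Proof.
move=> x0 n12; rewrite /psum [leRHS](bigID (fun t : 'I_m => (t < n1)%N))/=.
rewrite [in leRHS](eq_bigl (fun t : 'I_m => (t < n1)%N)) ?lerDl ?sumr_ge0// => t.
by case: (ltnP t n1) => h; rewrite ?andbT ?andbF// (leq_trans h n12).
Qed.

(** With signed weights the holding and backorder terms take one shape, linear in [pi] and [lam];
    continuity and both comparisons with the expected cost start from it. *)
Lemma lop_objectiveE h b s pi (lam : option 'I_m -> 'I_m -> R) :
  lop_objective h b s pi lam =
  \sum_j \sum_(t < m) lop_weight h b j t * (pi j * s - psum (lam j) t.+1).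
Proof.
rewrite big_option_sum addrC /lop_objective mulr_sumr; congr (_ + _).
apply: eq_bigr => j _; rewrite [RHS](bigID (fun t : 'I_m => (t < j)%N))/=.
congr (_ + _); rewrite mulr_sumr.
  by apply: eq_bigr => t ->.
apply: eq_big => [t|t]; first by rewrite -leqNgt.
by rewrite leqNgt => /negbTE ->; rewrite mulNr -mulrN opprB.
Qed.

(** Partial sums of nonnegative demands are monotone, so the inequalities at [j] alone fix the sign
    of the net inventory in every period, and each positive part is then the identity or zero. The
    factor [p] passes through the maxima because it is nonnegative; [p = 0] is allowed. *)
Lemma crosses_cost h b s j p l x :
  (forall t, 0 <= x t) -> 0 <= p -> (forall t, l t = p * x t) ->
  crosses s j p l ->
  \sum_(t < m) lop_weight h b j t * (p * s - psum l t.+1) =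
  p * path_cost h b s x.
Proof.
move=> x0 p0 /funext-> cr; rewrite /path_cost !mulr_sumr -big_split mulr_sumr.
have mono n1 n2 : (n1 <= n2)%N -> p * psum x n1 <= p * psum x n2.
  by move=> le; rewrite ler_wpM2l// le_psum.
apply: eq_bigr => t _ /=; rewrite psumZ.
rewrite [RHS]mulrDr !(mulrCA p) !(maxr_pMr _ _ p0) mulr0 mulrN (mulrBr p).
have pos q : 0 <= q -> h * q = h * Num.max q 0 + b * Num.max (- q) 0.
  by move=> q0; rewrite max_l// max_r ?oppr_le0// mulr0 addr0.
have neg q : q <= 0 -> - b * q = h * Num.max q 0 + b * Num.max (- q) 0.
  by move=> q0; rewrite max_r// max_l ?oppr_ge0// mulr0 add0r mulNr mulrN.
rewrite /lop_weight; case: j cr => [j|] /=; rewrite !psumZ; last first.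
  move=> cr.
  by apply: pos; rewrite subr_ge0 (le_trans _ cr)// mono.
move=> /andP[cr1 cr2]; case: ltnP => tj; first by apply: pos; rewrite subr_ge0 (le_trans _ cr1)// mono.
by apply: neg; rewrite subr_le0 (le_trans cr2)// mono.
Qed.

(* The guard 0 < n counts position 0 as unreached even when s = 0, so that the
   telescoping sum of the first_crossing indicators is 1. *)
Definition reached s x (n : nat) : bool := (0 < n)%N && (s <= psum x n).

(** On nonnegative paths [reached] is monotone in [n], so the difference is the indicator of the
    first crossing at [k]. In this form it inherits measurability from [reached]. *)
Definition first_crossing s x j : R :=
  if j is Some k then (reached s x k.+1)%:R - (reached s x k)%:R
  else 1 - (reached s x m)%:R.

Lemma sum_first_crossing s x : \sum_j first_crossing s x j = 1.
Proof.
rewrite big_option_sum /= -(big_mkord xpredT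
  (fun k => (reached s x k.+1)%:R - (reached s x k)%:R)).
by rewrite telescope_sumr// /reached /= subr0 subrK.
Qed.

(** Partial sums increase, so [reached] only switches from false to true, and at the switch [s] lies
    between consecutive partial sums. *)
Lemma first_crossing01 s x j : 0 <= s -> (forall t, 0 <= x t) ->
  first_crossing s x j = 0 \/ first_crossing s x j = 1 /\ crosses s j 1 x.
Proof.
move=> s0 x0; rewrite /first_crossing /crosses /reached !mul1r; case: j => [j|].
  have le_j : psum x j <= psum x j.+1 by rewrite le_psum.
  rewrite ltn0Sn /=; case: (leP s (psum x j.+1)) => [h1|h1].
    (* At position 0 the guard in [reached] gives the unreached case, and the lower crossing
       inequality reads [0 <= s]. *)
    case: posnP => [j0|j0]/=; first by right; split; rewrite ?subr0 ?j0 ?psum0 ?s0.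
    case: (leP s (psum x j)) => [h2|/ltW h2]; first by left; rewrite subrr.
    by right; split; rewrite ?subr0 ?h2.
  by left; rewrite [s <= psum x j]leNgt (le_lt_trans le_j h1) /= andbF subrr.
case: posnP => [m0|_]/=; first by right; split; rewrite ?subr0 ?[X in psum _ X]m0 ?psum0.
case: (leP s (psum x m)) => [h2|/ltW h2]; first by left; rewrite subrr.
by right; split; rewrite ?subr0 ?h2.
Qed.

End PathCost.

(** * Finitely supported probability distributions *)

Lemma exists_discrete_probability (d : measure_display) (T : measurableType d)
    (R : realType) (I : finType) (p : I -> R) (x : I -> T) :
  (forall k, 0 <= p k) -> \sum_k p k = 1 ->
  exists P : probability T R, forall f : T -> R, measurable_fun setT f ->
    'E_P[f]%E = (\sum_k p k * f (x k))%:E.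
Proof.
move=> p0 p1.
have I0 : (0 < #|I|)%N.
  rewrite lt0n; apply/eqP => /card0_eq I0; move: p1.
  by rewrite big_pred0// => /eqP; rewrite eq_sym oner_eq0.
case/card_gt0P: I0 => k0 _.
(* [msum] is indexed by naturals, so the atoms are listed along [enum I]; the default [k0] never
   occurs for [n] below [#|I|]. *)
pose pt n := nth k0 (enum I) n.
pose w n : {nonneg R} := NngNum (p0 (pt n)).
pose mu := msum (fun n => mscale (w n) \d_(x (pt n))) #|I|.
have sumE (V : nmodType) (F : I -> V) : \sum_(n < #|I|) F (pt n) = \sum_k F k.
  rewrite -(big_mkord xpredT (fun n => F (pt n))) cardE -(big_nth k0 xpredT F).
  by rewrite big_enum.
have muT : mu setT = 1%E.
  rewrite /mu /msum -[RHS]/(1%R%:E) -p1 -sumE -sumEFin; apply: eq_bigr => n _.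
  by rewrite -[LHS]/((p (pt n))%:E * \d_(x (pt n)) setT)%E diracT mule1.
pose MP := Measure_isProbability.Build _ _ _ mu muT.
pose P : probability T R := HB.pack mu MP.
exists P => f mf.
(* Integrals against a sum of measures split for nonnegative integrands; [f] is handled through its
   positive and negative parts, recombined at the end. *)
have pos (g : T -> \bar R) : (forall z, 0 <= g z)%E -> measurable_fun setT g ->
    (\int[mu]_z g z = \sum_k (p k)%:E * g (x k))%E.
  move=> g0 mg; rewrite ge0_integral_measure_sum// -sumE; apply: eq_bigr => n _.
  by rewrite ge0_integral_mscale//= integral_dirac// diracT mul1e.
have mF : measurable_fun setT (EFin \o f) by exact/measurable_EFinP.
rewrite unlock integralE pos//; last exact: measurable_funepos.
rewrite pos//; last exact: measurable_funeneg.
under eq_bigr => k _ do rewrite funeposE /= -EFin_max -EFinM.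
under [X in (_ - X)%E]eq_bigr => k _ do rewrite funenegE /= -EFin_max -EFinM.
rewrite !sumEFin -EFinB -sumrB; congr EFin; apply: eq_bigr => k _.
rewrite -mulrBr; congr (_ * _).
case: (lerP 0 (f (x k))) => [f0|/ltW f0].
  by rewrite (max_r (x := - _)) ?oppr_le0// subr0.
by rewrite (max_l (x := - _)) ?oppr_ge0// sub0r opprK.
Qed.

(** * Continuity of the LOP objective and closedness of its constraints *)

Lemma continuous_sumr (X : topologicalType) (R : realType) (I : Type)
    (r : seq I) (Q : pred I) (F : I -> X -> R) :
  (forall i, Q i -> continuous (F i)) ->
  continuous (fun u => \sum_(i <- r | Q i) F i u).
Proof. by apply: continuous_big => -[a b]; exact: cvgD cvg_fst cvg_snd. Qed.

Lemma closed_le_continuous (X : topologicalType) (R : realType) (f g : X -> R) :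
  continuous f -> continuous g -> closed [set u | f u <= g u].
Proof.
move=> cf cg; rewrite (_ : mkset _ = (g \- f) @^-1` [set r | 0 <= r]).
  apply: preimage_closed; last exact: closed_ge.
  by move=> u _; apply: cvgB; [exact: cg|exact: cf].
by apply/funext => u /=; rewrite subr_ge0.
Qed.

Lemma closed_eq_continuous (X : topologicalType) (R : realType) (f g : X -> R) :
  continuous f -> continuous g -> closed [set u | f u = g u].
Proof.
move=> cf cg; rewrite (_ : mkset _ = [set u | f u <= g u] `&` [set u | g u <= f u]).
  by apply: closedI; exact: closed_le_continuous.
apply/seteqP; split => u /=; first by move=> ->.
by move=> [fg gf]; apply/eqP; rewrite eq_le fg.
Qed.

Lemma closed_forall (X : topologicalType) (I : Type) (A : I -> X -> Prop) :
  (forall i, closed [set u | A i u]) -> closed [set u | forall i, A i u].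
Proof.
move=> cA; rewrite (_ : mkset _ = \bigcap_(i in setT) [set u | A i u]).
  by apply: closed_bigI => i _; exact: cA.
by apply/seteqP; split => u /= h; [move=> i _|move=> i]; exact: h.
Qed.

Section LopTopology.
Variables (R : realType) (m : nat) (h b s : R) (zlo mu zhi sigma : 'I_m -> R).
Variables (X : topologicalType) (pi : X -> option 'I_m -> R).
Variable (lam : X -> option 'I_m -> 'I_m -> R).
Hypothesis cont_pi : forall j, continuous (pi ^~ j).
Hypothesis cont_lam : forall j t, continuous (fun u => lam u j t).

Let cont_cst (r : R) : continuous (fun _ : X => r).
Proof. by move=> u; exact: cvg_cst. Qed.

Let contM (f g : X -> R) : continuous f -> continuous g ->
  continuous (fun u => f u * g u).
Proof. by move=> cf cg u; apply: cvgM; [exact: cf|exact: cg]. Qed.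

Let contB (f g : X -> R) : continuous f -> continuous g ->
  continuous (fun u => f u - g u).
Proof. by move=> cf cg u; apply: cvgB; [exact: cf|exact: cg]. Qed.

Let cont_norm (f : X -> R) : continuous f -> continuous (fun u => `|f u|).
Proof. by move=> cf u; apply: cvg_norm; exact: cf. Qed.

Lemma continuous_lop_objective :
  continuous (fun u => lop_objective h b s (pi u) (lam u)).
Proof.
under [X in continuous X]funext do rewrite lop_objectiveE.
apply: continuous_sumr => j _; apply: continuous_sumr => t _.
apply: contM => //; apply: contB; first exact: contM.
by apply: continuous_sumr => t' _.
Qed.

(** Every constraint is an equation or a nonstrict inequality between continuous functions;
    two-sided bounds are split to write the set as an intersection of closed sets. *)
Lemma closed_lop_feasible :
  closed [set u | lop_feasible s zlo mu zhi sigma (pi u) (lam u)].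
Proof.
rewrite (_ : mkset _ = [set u | \sum_j pi u j = 1] `&`
  [set u | forall t, \sum_j lam u j t = mu t] `&`
  [set u | forall t, \sum_j `|lam u j t - pi u j * mu t| <= sigma t] `&`
  [set u | forall t j, pi u j * zlo t <= lam u j t] `&`
  [set u | forall t j, lam u j t <= pi u j * zhi t] `&`
  [set u | forall j : 'I_m,
    \sum_(t < m | (t < j)%N) lam u (Some j) t <= pi u (Some j) * s] `&`
  [set u | forall j : 'I_m,
    pi u (Some j) * s <= \sum_(t < m | (t <= j)%N) lam u (Some j) t] `&`
  [set u | \sum_(t < m) lam u None t <= pi u None * s] `&`
  [set u | forall j, 0 <= pi u j]).
  have cpi j c : continuous (fun u => pi u j * c) by exact: contM.
  apply: closedI; last by apply: closed_forall => j; exact: closed_le_continuous.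
  apply: closedI; last first.
    by apply: closed_le_continuous => //; exact: continuous_sumr.
  apply: closedI; last first.
    apply: closed_forall => j; apply: closed_le_continuous => //.
    by apply: continuous_sumr => t _.
  apply: closedI; last first.
    apply: closed_forall => j; apply: closed_le_continuous => //.
    by apply: continuous_sumr => t _.
  apply: closedI; last first.
    by apply: closed_forall => t; apply: closed_forall => j; exact: closed_le_continuous.
  apply: closedI; last first.
    by apply: closed_forall => t; apply: closed_forall => j; exact: closed_le_continuous.
  apply: closedI; last first.
    apply: closed_forall => t; apply: closed_le_continuous => //.
    by apply: continuous_sumr => j _; apply: cont_norm; apply: contB.
  apply: closedI; first by apply: closed_eq_continuous => //; exact: continuous_sumr.
  apply: closed_forall => t; apply: closed_eq_continuous => //.
  by apply: continuous_sumr => j _.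
apply/seteqP; split => u /=.
  case=> c1 c2 c3 c4 c5 c6 c7; do !split => //.
  - by move=> t j; case/andP: (c4 t j).
  - by move=> t j; case/andP: (c4 t j).
  - by move=> j; case/andP: (c5 j).
  - by move=> j; case/andP: (c5 j).
move=> [[[[[[[[c1 c2] c3] c4] c5] c6] c7] c8] c9]; split => //.
- by move=> t j; rewrite c4 c5.
- by move=> j; rewrite c6 c7.
Qed.

End LopTopology.

(** * Compactness of the feasible set and attainment of the maximum *)

Section LopAttained.
Variables (R : realType) (m : nat) (h b s : R) (zlo mu zhi sigma : 'I_m -> R).

(* A pair (pi, lam) is a point u of a finite power of R, with
   pi j = u (j, None) and lam j t = u (j, Some t). *)
Let X : topologicalType := prod_topology (fun _ : option 'I_m * option 'I_m => R).
Let pi (u : X) j : R := u (j, None).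
Let lam (u : X) j t : R := u (j, Some t).

Let cont_pi j : continuous (fun u => pi u j).
Proof. exact: (@proj_continuous _ (fun=> R)). Qed.

Let cont_lam j t : continuous (fun u => lam u j t).
Proof. exact: (@proj_continuous _ (fun=> R)). Qed.

Let feasible := [set u | lop_feasible s zlo mu zhi sigma (pi u) (lam u)].

(** Nonnegative masses with sum 1 lie in [[0, 1]], and the support bounds then give
    [|lam j t| <= |zlo t| + |zhi t|]. Hence one radius [M] bounds all coordinates, and the feasible
    set is closed in a box that is compact by Tychonoff. *)
Let compact_feasible : compact feasible.
Proof.
pose M := 1 + \sum_t (`|zlo t| + `|zhi t|).
have S0 (Q : pred 'I_m) : 0 <= \sum_(t | Q t) (`|zlo t| + `|zhi t|).
  by rewrite sumr_ge0// => t _; rewrite addr_ge0.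
apply: (@subclosed_compact X _ [set u | forall k, `[- M, M]%classic (u k)]).
- exact: closed_lop_feasible.
- by apply: (@tychonoff _ (fun=> R) (fun=> `[- M, M]%classic)) => k; exact: segment_compact.
- move=> u [p1 _ _ supp _ _ p0] [j [t|]] /=; rewrite in_itv/= -ler_norml.
  + have p1j : pi u j <= 1.
      by rewrite -p1 (bigD1 j)//= lerDl sumr_ge0.
    have := supp t j; rewrite -/(lam u j t) => /andP[l1 l2].
    have := p0 j => p0j.
    apply: (@le_trans _ _ (`|zlo t| + `|zhi t|)); last first.
      by rewrite /M (bigD1 t)//= addrCA lerDl addr_ge0// S0.
    have zlo1 : - `|zlo t| <= pi u j * zlo t.
      rewrite lerNl -mulrN (le_trans (ler_wpM2l p0j (ler_norm _)))// normrN.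
      by rewrite -[leRHS]mul1r ler_wpM2r.
    have zhi1 : pi u j * zhi t <= `|zhi t|.
      rewrite (le_trans (ler_wpM2l p0j (ler_norm _)))//.
      by rewrite -[leRHS]mul1r ler_wpM2r.
    rewrite ler_norml (le_trans _ l1)/= ?(le_trans l2)//.
      by rewrite (le_trans zhi1)// lerDr.
    by rewrite (le_trans _ zlo1)// lerN2 lerDl.
  + rewrite ger0_norm ?p0// -/(pi u j) (@le_trans _ _ 1)// ?lerDl ?S0//.
    by rewrite -p1 (bigD1 j)//= lerDl sumr_ge0.
Qed.

Lemma lop_attained : lop_values h b s zlo mu zhi sigma !=set0 ->
  exists v, is_maximum (lop_values h b s zlo mu zhi sigma) v.
Proof.
move=> [v0 [pi0 [lam0 [feas0 _]]]].
pose obj (u : X) := lop_objective h b s (pi u) (lam u).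
(* Packs a pair into a point of [X], from which [pi] and [lam] recover it by computation. *)
pose toX (p : option 'I_m -> R) (l : option 'I_m -> 'I_m -> R) : X :=
  fun k => if k.2 is Some t then l k.1 t else p k.1.
have [|||u] := @compact_EVT_max X R obj feasible.
- by exists (toX pi0 lam0).
- exact: compact_feasible.
- by apply: continuous_subspaceT; exact: continuous_lop_objective.
move=> /set_mem fu umax; exists (obj u); split; first by exists (pi u), (lam u).
move=> _ [p [l [fpl ->]]]; exact: (umax (toX p l) (mem_set _)).
Qed.

End LopAttained.

(** * Positions in the cyclic interval, and measurability of demands and costs *)

Lemma val_period (T : nat) (t1 : 'I_T) k :
  period t1 k = ((t1 + k) %% T)%N :> nat.
Proof.
elim: k => [|k IH]; first by rewrite addn0 modn_small.
by rewrite /period iterS /= -/(period t1 k) IH -addn1 modnDml -addnA addn1.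
Qed.

Lemma horizon_le (T : nat) (t1 t2 : 'I_T) : (horizon t1 t2 <= T)%N.
Proof.
rewrite /horizon; case: ltnP => [_|le21].
  by rewrite (leq_trans (leq_subr _ _))// ltnW.
by rewrite leq_subLR leq_add2r.
Qed.

(** Positions stay below [horizon t1 t2 <= T], so the walk from [t1] never closes up; demands can
    thus be prescribed position by position. *)
Lemma period_inj (T : nat) (t1 t2 : 'I_T) :
  injective (fun k : 'I_(horizon t1 t2) => period t1 k).
Proof.
move=> k1 k2 /(congr1 val); rewrite /= !val_period => /eqP.
have lt_T (k : 'I_(horizon t1 t2)) : (k < T)%N.
  exact: leq_trans (ltn_ord k) (horizon_le t1 t2).
by rewrite eqn_modDl !modn_small// => /eqP/val_inj.
Qed.

Lemma measurable_demand (R : realType) (N T : nat) (i : 'I_N) (t : 'I_T) :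
  measurable_fun setT (@demand R N T i t).
Proof. exact: measurableT_comp (measurable_tnth t) (measurable_tnth i). Qed.

Lemma measurable_demand_itv (R : realType) (N T : nat) (i : 'I_N) (t : 'I_T)
    (lo hi : R) :
  measurable [set z : N.-tuple (T.-tuple R) | lo <= demand i t z <= hi].
Proof.
rewrite (_ : mkset _ = demand i t @^-1` `[lo, hi]).
  by rewrite -[X in measurable X]setTI; exact: measurable_demand.
by apply/seteqP; split => z; rewrite /= in_itv.
Qed.

Lemma measurable_psum (R : realType) (d : measure_display)
    (Z : measurableType d) (m : nat) (x : Z -> 'I_m -> R) n :
  (forall t, measurable_fun setT (x ^~ t)) ->
  measurable_fun setT (fun z => psum (x z) n).
Proof.
move=> mx; rewrite /psum; under eq_fun do rewrite big_mkcond/=.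
by apply: measurable_sum => t; case: (t < n)%N.
Qed.

Lemma measurable_path_cost (R : realType) (d : measure_display)
    (Z : measurableType d) (m : nat) (h b s : R) (x : Z -> 'I_m -> R) :
  (forall t, measurable_fun setT (x ^~ t)) ->
  measurable_fun setT (fun z => path_cost h b s (x z)).
Proof.
move=> mx.
have mnet t : measurable_fun setT (fun z => s - psum (x z) t).
  by apply: measurable_funB => //; exact: measurable_psum.
apply: measurable_funD; apply: measurable_funM => //; apply: measurable_sum => t.
  exact: measurable_maxr.
by apply: measurable_maxr => //; apply: measurableT_comp => //; exact: mnet.
Qed.

(** Holds by conversion, [t' <= t] and [t' < t.+1] having the same normal form. *)
Lemma inventory_costE (R : realType) (N T : nat) (h b : R) (i : 'I_N)
    (t1 t2 : 'I_T) (s : nat) :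
  inventory_cost h b i t1 t2 s = fun z : N.-tuple (T.-tuple R) =>
  path_cost h b s%:R (fun k : 'I_(horizon t1 t2) => demand i (period t1 k) z).
Proof. by []. Qed.

(** * From a feasible point of the LOP to a distribution *)

Section FromLop.
Variables (R : realType) (N T : nat) (zlo mu zhi sigma : 'I_N -> 'I_T -> R).

(** Atom [k] has mass [p k] and location [v k]; the hypotheses are phrased through the weighted
    location [L k], which is what the LOP variables [lam] describe. *)
Lemma exists_discrete_ambiguity (I : finType) (p : I -> R)
    (v L : I -> 'I_N -> 'I_T -> R) :
  (forall k, 0 <= p k) -> \sum_k p k = 1 ->
  (forall k i t, L k i t = p k * v k i t) ->
  (forall i t, \sum_k L k i t = mu i t) ->
  (forall i t, \sum_k `|L k i t - p k * mu i t| <= sigma i t) ->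
  (forall k i t, p k * zlo i t <= L k i t <= p k * zhi i t) ->
  exists2 P, ambiguity_set zlo mu zhi sigma P &
    forall (m : nat) (i : 'I_N) (tau : 'I_m -> 'I_T) (h b s : R),
    'E_P[fun z => path_cost h b s (fun k => demand i (tau k) z)]%E =
    (\sum_k p k * path_cost h b s (fun r => v k i (tau r)))%:E.
Proof.
move=> p0 p1 LE Lmu Lsigma Lsupp.
pose x k : N.-tuple (T.-tuple R) := [tuple [tuple v k i t | t < T] | i < N].
have dx i t k : demand i t (x k) = v k i t by rewrite /demand !tnth_mktuple.
have [P PE] := exists_discrete_probability x p0 p1.
exists P => [i t|m i tau h b s]; last first.
  rewrite PE; last by apply: measurable_path_cost => k; exact: measurable_demand.
  congr EFin; apply: eq_bigr => k _; congr (_ * path_cost _ _ _ _).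
  by apply/funext => r; rewrite dx.
split.
- have mA := @measurable_demand_itv R N T i t (zlo i t) (zhi i t).
  (* The support condition is the expectation of an indicator. An atom of mass zero may lie outside
     the bounds, since it contributes nothing. *)
  rewrite -expectation_indic// PE// -p1; congr EFin; apply: eq_bigr => k _.
  have := Lsupp k i t; rewrite LE; have := p0 k.
  rewrite le_eqVlt => /predU1P[<-|pk]; first by move=> _; rewrite mul0r.
  by rewrite !ler_pM2l// => kA; rewrite indicE mem_set ?mulr1// /mkset dx.
- rewrite PE; last exact: measurable_demand.
  by rewrite -Lmu; congr EFin; apply: eq_bigr => k _; rewrite dx LE.
- rewrite PE; last first.
    apply: measurableT_comp => //; apply: measurable_funB => //.
    exact: measurable_demand.
  rewrite lee_fin (le_trans _ (Lsigma i t))// le_eqVlt; apply/orP; left; apply/eqP.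
  apply: eq_bigr => k _; rewrite dx LE -mulrBr normrM.
  by rewrite (ger0_norm (p0 k)).
Qed.

Hypothesis data : forall i t,
  [/\ 0 <= zlo i t, zlo i t < mu i t, mu i t < zhi i t & 0 <= sigma i t].

(** The point mass at [mu] has dispersion zero. Through its first-crossing decomposition it shows
    the LOP to be feasible. *)
Lemma ambiguity_set_neq0 : ambiguity_set zlo mu zhi sigma !=set0.
Proof.
pose one (_ : unit) : R := 1; pose v (_ : unit) := mu.
have sum1 (F : unit -> R) : \sum_k F k = F tt.
  by rewrite (bigD1 tt)//= big1 ?addr0// => -[].
have [||||||P AP _] := @exists_discrete_ambiguity _ one v v; last by exists P.
- by move=> k; exact: ler01.
- by rewrite sum1.
- by move=> k i t; rewrite mul1r.
- by move=> i t; rewrite sum1.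
- by move=> i t; rewrite sum1 mul1r subrr normr0; have [] := data i t.
- by move=> k i t; rewrite !mul1r; have [_ /ltW -> /ltW ->] := data i t.
Qed.

Lemma lop_feasible_ambiguity (h b : R) (i : 'I_N) (t1 t2 : 'I_T) (s : nat) pi lam :
  lop_feasible s%:R
    (fun t : 'I_(horizon t1 t2) => zlo i (period t1 t))
    (fun t => mu i (period t1 t)) (fun t => zhi i (period t1 t))
    (fun t => sigma i (period t1 t)) pi lam ->
  exists2 P, ambiguity_set zlo mu zhi sigma P &
    'E_P[inventory_cost h b i t1 t2 s]%E = (lop_objective h b s%:R pi lam)%:E.
Proof.
case=> pi1 lam_mean lam_disp lam_supp lam_cross lam_nocross pi0.
(* Zero mass forces [lam j t = 0] by the support bounds, so division by zero in [lam j k / pi j]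
   does no harm. *)
have lam0 j t : pi j = 0 -> lam j t = 0.
  by move=> j0; apply/eqP; have := lam_supp t j; rewrite j0 !mul0r eq_le andbC.
(* The [pick] inverts [period t1] on J; outside J, and for other products, demand is the mean. *)
pose v j (i' : 'I_N) (t : 'I_T) : R := if i' == i then
  (if [pick k : 'I_(horizon t1 t2) | period t1 k == t] is Some k
   then lam j k / pi j else mu i' t) else mu i' t.
pose L j (i' : 'I_N) (t : 'I_T) : R := pi j * v j i' t.
have vJ j (k : 'I_(horizon t1 t2)) : v j i (period t1 k) = lam j k / pi j.
  rewrite /v eqxx; case: pickP => [k' /eqP/period_inj -> //|/(_ k)].
  by rewrite eqxx.
have piV j k : pi j * (lam j k / pi j) = lam j k.
  have [j0|j0] := eqVneq (pi j) 0; first by rewrite j0 lam0// mul0r.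
  by rewrite mulrC divfK.
(* Each coordinate either belongs to J for product [i], where the LOP constraints apply, or is
   frozen at its mean, where [data] suffices. *)
have LP i' t : (exists k : 'I_(horizon t1 t2),
      [/\ i' = i, t = period t1 k & forall j, L j i' t = lam j k]) \/
    forall j, L j i' t = pi j * mu i' t.
  rewrite /L /v; case: eqVneq => [->|_]; last by right.
  case: pickP => [k /eqP <-|_]; last by right.
  by left; exists k; split => // j; rewrite piV.
have [||||||P AP PE] := @exists_discrete_ambiguity _ pi v L.
- by [].
- by [].
- by [].
- move=> i' t; case: (LP i' t) => [[k [-> -> LE]]|LE].
    by under eq_bigr do rewrite LE; exact: lam_mean.
  by under eq_bigr do rewrite LE; rewrite -mulr_suml pi1 mul1r.
- move=> i' t; case: (LP i' t) => [[k [-> -> LE]]|LE].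
    by under eq_bigr do rewrite LE; exact: lam_disp.
  rewrite big1 => [|j _]; first by have [] := data i' t.
  by rewrite LE subrr normr0.
- move=> j i' t; case: (LP i' t) => [[k [-> -> ->]]|->]; first exact: lam_supp.
  by have [_ lo hi _] := data i' t; rewrite !ler_wpM2l// ltW.
exists P => //; rewrite inventory_costE PE lop_objectiveE; congr EFin.
apply: eq_bigr => j _; apply/esym/crosses_cost => //.
- move=> k; rewrite vJ divr_ge0//.
  have /andP[+ _] := lam_supp k j; apply: le_trans.
  by rewrite mulr_ge0//; have [] := data i (period t1 k).
- by move=> k; rewrite vJ piV.
- case: j => [j|] /=; first exact: lam_cross.
  by rewrite psum_full.
Qed.

End FromLop.

(** * Real integrals of bounded functions and of finite sums *)

Section Rintegral.
Variables (d : measure_display) (Z : measurableType d) (R : realType).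
Variable P : probability Z R.

Lemma bounded_integrable (f : Z -> R) (M : R) :
  measurable_fun setT f -> (forall z, `|f z| <= M) ->
  P.-integrable setT (EFin \o f).
Proof.
move=> mf fM; apply: measurable_bounded_integrable => //.
  exact: fin_num_fun_lty (fin_num_measure P).
by exists M; split; [exact: num_real|move=> r Mr z _ /=; rewrite (le_trans (fM z))// ltW].
Qed.

Lemma integrable_sumr (I : Type) (r : seq I) (Q : pred I) (f : I -> Z -> R) :
  (forall k, P.-integrable setT (EFin \o f k)) ->
  P.-integrable setT (EFin \o (fun z => \sum_(k <- r | Q k) f k z)).
Proof.
move=> fint; rewrite (_ : _ \o _ = fun z => \sum_(k <- r | Q k) (EFin \o f k) z).
  by apply: integrable_sum => // k _; exact: fint.
by apply/funext => z /=; rewrite sumEFin.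
Qed.

Lemma Rintegral_sum (I : Type) (r : seq I) (Q : pred I) (f : I -> Z -> R) :
  (forall k, P.-integrable setT (EFin \o f k)) ->
  \int[P]_z (\sum_(k <- r | Q k) f k z) = \sum_(k <- r | Q k) \int[P]_z f k z.
Proof.
move=> fint; rewrite {1}/Rintegral.
under eq_integral do rewrite -sumEFin.
rewrite integral_sum// (eq_bigr (fun k => (\int[P]_z f k z)%:E)) ?sumEFin// => k _.
by rewrite fineK//; apply: integrable_fin_num => //; exact: fint.
Qed.

End Rintegral.

(** * From a distribution to a feasible point of the LOP *)

Section FromDistribution.
Variables (d : measure_display) (Z : measurableType d) (R : realType).
Variables (P : probability Z R) (m : nat) (h b s : R).
Variables (zlo mu zhi sigma : 'I_m -> R) (c : Z -> 'I_m -> R).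
Hypotheses (s0 : 0 <= s) (zlo0 : forall t, 0 <= zlo t).
Hypothesis mc : forall t, measurable_fun setT (c ^~ t).
Hypothesis supp : forall z t, zlo t <= c z t <= zhi t.
Hypothesis mean : forall t, \int[P]_z c z t = mu t.
Hypothesis disp : forall t, \int[P]_z `|c z t - mu t| <= sigma t.

Let c0 z t : 0 <= c z t.
Proof. by have /andP[+ _] := supp z t; apply: le_trans. Qed.

Let chi z j := first_crossing s (c z) j.

Let chi01 z j : chi z j = 0 \/ chi z j = 1 /\ crosses s j 1 (c z).
Proof. exact: first_crossing01. Qed.

Let chi0 z j : 0 <= chi z j.
Proof. by case: (chi01 z j) => [->|[-> _]]. Qed.

Let mreached n : measurable_fun setT (fun z => (reached s (c z) n)%:R : R).
Proof.
have mb : measurable_fun setT (fun z => reached s (c z) n).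
  apply: measurable_and => //; apply: measurable_fun_ler => //.
  exact: measurable_psum.
rewrite (_ : (fun _ => _) = fun z => if reached s (c z) n then 1 else 0).
  exact: measurable_fun_ifT.
by apply/funext => z; case: reached.
Qed.

Let mchi j : measurable_fun setT (chi ^~ j).
Proof.
case: j => [j|]; rewrite /chi /=; apply: measurable_funB => //; exact: mreached.
Qed.

Let ichi j : P.-integrable setT (EFin \o chi ^~ j).
Proof.
apply: (@bounded_integrable _ _ _ _ _ 1) => // z.
by case: (chi01 z j) => [->|[-> _]]; rewrite ?normr0 ?normr1.
Qed.

Let ichic j t : P.-integrable setT (EFin \o (fun z => chi z j * c z t)).
Proof.
apply: (@bounded_integrable _ _ _ _ _ (zhi t)) => [|z].
  exact: measurable_funM.
have /andP[_ czhi] := supp z t; rewrite ger0_norm ?mulr_ge0//.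
by case: (chi01 z j) => [->|[-> _]]; rewrite ?mul0r ?mul1r// (le_trans _ czhi).
Qed.

Let ipsum j n : P.-integrable setT
  (EFin \o (fun z => psum (fun t => chi z j * c z t) n)).
Proof.
by apply: integrable_sumr => t; exact: ichic.
Qed.

Let iZr (f : Z -> R) k : P.-integrable setT (EFin \o f) ->
  P.-integrable setT (EFin \o (fun z => f z * k)).
Proof. by move=> fi; exact: (integrableZr measurableT k fi). Qed.

Let iB (f g : Z -> R) : P.-integrable setT (EFin \o f) ->
  P.-integrable setT (EFin \o g) ->
  P.-integrable setT (EFin \o (fun z => f z - g z)).
Proof. by move=> fi gi; exact: (integrableB measurableT fi gi). Qed.

Let pi j := \int[P]_z chi z j.
Let lam j t := \int[P]_z (chi z j * c z t).

Let psum_lam j n : psum (lam j) n = \int[P]_z psum (fun t => chi z j * c z t) n.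
Proof. by rewrite /psum Rintegral_sum. Qed.

Let piZ j k : pi j * k = \int[P]_z (chi z j * k).
Proof. by rewrite RintegralZr. Qed.

(** Off piece [j] all terms vanish, and on it the scale is 1; homogeneity makes the crossing
    inequalities hold at every [z], ready to be integrated. *)
Let crosses_chi z j : crosses s j (chi z j) (fun t => chi z j * c z t).
Proof.
case: (chi01 z j) => [->|[-> cr]].
  by case: j => [j|] /=; rewrite !psumZ !mul0r lexx.
by case: j cr => [j|] /=; rewrite !psumZ !mul1r.
Qed.

(** Each constraint integrates a pointwise relation: the indicators sum to 1, and the bounds and
    crossing inequalities survive multiplication by them. *)
Lemma first_crossing_feasible : lop_feasible s zlo mu zhi sigma pi lam.
Proof.
split.
- rewrite /pi -Rintegral_sum//.
  under eq_Rintegral do rewrite sum_first_crossing.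
  by rewrite Rintegral_cst// [X in fine X](probability_setT P) mul1r.
- move=> t; rewrite /lam -Rintegral_sum// -mean; apply: eq_Rintegral => z _.
  by rewrite -mulr_suml sum_first_crossing mul1r.
- move=> t.
  have icmu : P.-integrable setT (EFin \o (fun z => c z t - mu t)).
    apply: (@bounded_integrable _ _ _ _ _ (zhi t + `|mu t|)) => [|z].
      exact: measurable_funB.
    rewrite (le_trans (ler_normB _ _))// lerD2r ger0_norm//.
    by have /andP[] := supp z t.
  have ichicmu j : P.-integrable setT (EFin \o (fun z => chi z j * (c z t - mu t))).
    under [X in EFin \o X]funext do rewrite mulrBr.
    by apply: iB => //; exact: iZr.
  apply: le_trans (disp t).
  (* Summing over the pieces restores the full mean absolute deviation; on each piece, the absolute
     value of an integral is at most the integral of the absolute value. *)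
  have -> : \int[P]_z `|c z t - mu t| =
      \sum_j \int[P]_z `|chi z j * (c z t - mu t)|.
    rewrite -Rintegral_sum => [|j]; last exact: (integrable_norm (ichicmu j)).
    apply: eq_Rintegral => z _.
    rewrite -[LHS]mul1r -(sum_first_crossing s (c z)) mulr_suml.
    by apply: eq_bigr => j _; rewrite normrM (ger0_norm (chi0 z j)).
  apply: ler_sum => j _; rewrite piZ -RintegralB//; last exact: iZr.
  under eq_Rintegral do rewrite -mulrBr.
  exact: le_normr_Rintegral.
- move=> t j; rewrite !piZ; apply/andP; split; apply: le_Rintegral => //;
    by [exact: iZr|move=> z _; rewrite ler_wpM2l//; have /andP[] := supp z t].
- move=> j; rewrite -/(psum _ _) -/(psum _ j.+1) !psum_lam piZ.
  by apply/andP; split; apply: le_Rintegral => //; try exact: iZr;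
    move=> z _; have /andP[] := crosses_chi z (Some j).
- rewrite -psum_full psum_lam piZ; apply: le_Rintegral => //; first exact: iZr.
  by move=> z _; exact: (crosses_chi z None).
- by move=> j; apply: Rintegral_ge0.
Qed.

(** Multiplying the cost by [1 = \sum_j chi z j] and applying [crosses_cost] with [p = chi z j]
    makes it linear piece by piece, so integration commutes with the objective. *)
Lemma first_crossing_objective :
  'E_P[fun z => path_cost h b s (c z)]%E = (lop_objective h b s pi lam)%:E.
Proof.
pose F j t z := lop_weight h b j t *
  (chi z j * s - psum (fun t => chi z j * c z t) t.+1).
have iG j (t : 'I_m) : P.-integrable setT
    (EFin \o (fun z => chi z j * s - psum (fun t => chi z j * c z t) t.+1)).
  by apply: iB => //; exact: iZr.
have iF j t : P.-integrable setT (EFin \o F j t).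
  exact: (@integrableZl _ _ _ P setT measurableT (lop_weight h b j t) _ (iG j t)).
have iFs j : P.-integrable setT (EFin \o (fun z => \sum_t F j t z)).
  by apply: integrable_sumr => t; exact: iF.
have costE : (fun z => path_cost h b s (c z)) = fun z => \sum_j \sum_t F j t z.
  apply/funext => z; rewrite -[LHS]mul1r -(sum_first_crossing s (c z)) mulr_suml.
  by apply: eq_bigr => j _; rewrite /F (crosses_cost _ _ (c0 z))//; exact: crosses_chi.
have icost : P.-integrable setT (EFin \o (fun z => path_cost h b s (c z))).
  by rewrite costE; apply: integrable_sumr => j; exact: iFs.
rewrite unlock -[LHS]fineK; last exact: (integrable_fin_num measurableT icost).
rewrite -/(Rintegral _ _ _) costE lop_objectiveE Rintegral_sum//; congr EFin.
apply: eq_bigr => j _; rewrite Rintegral_sum//; apply: eq_bigr => t _.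
rewrite /F RintegralZl//; congr (_ * _).
by rewrite RintegralB//; [rewrite -piZ psum_lam|exact: iZr].
Qed.

End FromDistribution.

Lemma ambiguity_lop_feasible (R : realType) (N T : nat) (h b : R)
    (zlo mu zhi sigma : 'I_N -> 'I_T -> R)
    (data : forall i t,
      [/\ 0 <= zlo i t, zlo i t < mu i t, mu i t < zhi i t & 0 <= sigma i t])
    (i : 'I_N) (t1 t2 : 'I_T) (s : nat) (P : probability (N.-tuple (T.-tuple R)) R) :
  ambiguity_set zlo mu zhi sigma P -> exists pi lam,
  lop_feasible s%:R
    (fun t : 'I_(horizon t1 t2) => zlo i (period t1 t))
    (fun t => mu i (period t1 t)) (fun t => zhi i (period t1 t))
    (fun t => sigma i (period t1 t)) pi lam /\
  'E_P[inventory_cost h b i t1 t2 s]%E = (lop_objective h b s%:R pi lam)%:E.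
Proof.
move=> AP.
(* Demands respect their bounds only almost surely; clamped ones do everywhere. *)
pose c z (k : 'I_(horizon t1 t2)) : R := Num.max (zlo i (period t1 k))
  (Num.min (zhi i (period t1 k)) (demand i (period t1 k) z)).
have lohi t : zlo i t <= zhi i t.
  by have [_ lo hi _] := data i t; rewrite ltW// (lt_trans lo).
have supp z (k : 'I_(horizon t1 t2)) : zlo i (period t1 k) <= c z k <= zhi i (period t1 k).
  by rewrite /c le_max lexx ge_max lohi ge_min lexx.
have mc (k : 'I_(horizon t1 t2)) : measurable_fun setT (c ^~ k).
  apply: measurable_maxr => //; apply: measurable_minr => //.
  exact: measurable_demand.
(* There are finitely many positions, so the almost sure bounds hold jointly, and within them
   clamping changes nothing. *)
have aeE : \forall z \ae P, forall k, c z k = demand i (period t1 k) z.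
  apply: filter_forall => k; have [P1 _ _] := AP i (period t1 k).
  have mA := @measurable_demand_itv R N T i (period t1 k)
    (zlo i (period t1 k)) (zhi i (period t1 k)).
  exists (~` [set z | zlo i (period t1 k) <= demand i (period t1 k) z <=
    zhi i (period t1 k)]); split; first exact: measurableC.
    by rewrite probability_setC// P1 subee.
  move=> z /=; apply: contra_not => /andP[lo hi].
  by rewrite /c min_r// max_r.
(* Stated for functionals of the whole path, to transfer the mean, the absolute deviation and the
   cost alike. *)
have ae_E (f : N.-tuple (T.-tuple R) -> ('I_(horizon t1 t2) -> R) -> R) :
    measurable_fun setT (fun z => f z (fun k => demand i (period t1 k) z)) ->
    measurable_fun setT (fun z => f z (c z)) ->
    'E_P[fun z => f z (fun k => demand i (period t1 k) z)]%E =
    'E_P[fun z => f z (c z)]%E.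
  move=> mf1 mf2; rewrite unlock; apply: ae_eq_integral => //;
    [exact/measurable_EFinP|exact/measurable_EFinP|].
  by apply: filterS aeE => z cz _; congr (f _ _)%:E; apply/funext => k; rewrite cz.
have mean (k : 'I_(horizon t1 t2)) : \int[P]_z c z k = mu i (period t1 k).
  have [_ + _] := AP i (period t1 k).
  rewrite (ae_E (fun _ x => x k))//; last exact: measurable_demand.
  by rewrite unlock /Rintegral => ->.
have disp (k : 'I_(horizon t1 t2)) : \int[P]_z `|c z k - mu i (period t1 k)| <= sigma i (period t1 k).
  have [_ _] := AP i (period t1 k).
  have mabs (f : N.-tuple (T.-tuple R) -> R) : measurable_fun setT f ->
      measurable_fun setT (fun z => `|f z - mu i (period t1 k)|).
    by move=> mf; apply: measurableT_comp => //; exact: measurable_funB.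
  rewrite (ae_E (fun _ x => `|x k - mu i (period t1 k)|))//; last 2 first.
  - by apply: mabs; exact: measurable_demand.
  - exact: mabs.
  (* The given bound lives in the extended reals; boundedness of [c] makes the integral finite, so
     [fine] loses nothing. *)
  rewrite unlock -lee_fin /Rintegral fineK//.
  apply: integrable_fin_num => //.
  apply: (@bounded_integrable _ _ _ _ _
    (zhi i (period t1 k) + `|mu i (period t1 k)|)) => [|z]; first exact: mabs.
  rewrite normr_id (le_trans (ler_normB _ _))// lerD2r.
  have /andP[lo hi] := supp z k; rewrite ger0_norm// (le_trans _ lo)//.
  by have [] := data i (period t1 k).
have zlo0 (k : 'I_(horizon t1 t2)) : 0 <= zlo i (period t1 k) by have [] := data i (period t1 k).
exists (fun j => \int[P]_z first_crossing s%:R (c z) j),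
  (fun j k => \int[P]_z (first_crossing s%:R (c z) j * c z k)); split.
  exact: first_crossing_feasible.
rewrite -(@first_crossing_objective _ _ _ _ _ h b _ _ _ _ _ zlo0 mc supp)//.
rewrite inventory_costE (ae_E (fun _ => path_cost h b s%:R))//.
- by apply: measurable_path_cost => k; exact: measurable_demand.
- exact: measurable_path_cost.
Qed.

(** * Equality of the worst-case cost and the LOP maximum *)

Theorem theorem1 (R : realType) (N T : nat) (hN : (1 <= N)%N) (hT : (1 <= T)%N)
    (Atemporal : {set 'I_T * 'I_T})
    (h b : R) (h_ge0 : 0 <= h) (b_ge0 : 0 <= b)
    (zlo mu zhi sigma : 'I_N -> 'I_T -> R)
    (data : forall i t,
      [/\ 0 <= zlo i t, zlo i t < mu i t, mu i t < zhi i t & 0 <= sigma i t])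
    (i : 'I_N) (t1 t2 : 'I_T) (ht : (t1, t2) \in Atemporal) (s : nat) :
  exists2 v : R,
    is_maximum
      (@lop_values R (horizon t1 t2) h b s%:R
         (fun t => zlo i (period t1 t)) (fun t => mu i (period t1 t))
         (fun t => zhi i (period t1 t)) (fun t => sigma i (period t1 t))) v
    & worst_case_cost h b zlo mu zhi sigma i t1 t2 s = v%:E.
Proof.
set V := lop_values _ _ _ _ _ _ _.
(* Equality of the two sets of values, one inclusion per construction, reduces the claim to the
   maximum of [V] being attained. *)
have costs : [set 'E_P[inventory_cost h b i t1 t2 s]%E |
    P in ambiguity_set zlo mu zhi sigma] = EFin @` V.
  apply/seteqP; split => [_ [P AP <-]|_ [_ [pi [lam [feas ->]]] <-]].
    have [pi [lam [feas PE]]] := ambiguity_lop_feasible h b data i t1 t2 s AP.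
    by exists (lop_objective h b s%:R pi lam) => //; exists pi, lam.
  have [P AP PE] := lop_feasible_ambiguity data h b feas.
  by exists P.
have [v [Vv maxv]] : exists v, is_maximum V v.
  apply: lop_attained; have [P AP] := ambiguity_set_neq0 data.
  have [pi [lam [feas _]]] := ambiguity_lop_feasible h b data i t1 t2 s AP.
  by exists (lop_objective h b s%:R pi lam), pi, lam.
exists v => //; rewrite /worst_case_cost costs.
apply/eqP; rewrite eq_le; apply/andP; split.
  by apply: ge_ereal_sup => _ [w Vw <-]; rewrite lee_fin maxv.
by apply: ereal_sup_ubound; exists v.
Qed.
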